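(* Let $\Upsilon$ be a finite purely relational vocabulary, let $X$ be an infinite connected $\Upsilon$-structure of bounded degree with the duplicate substructure property, let $T$ be the almost sure theory for finite substructures of $X$, and let $0<p<1$. Then with probability $1$ a random substructure of $X$ is a model of $T$. In particular, almost all random substructures of $X$ are elementarily equivalent (there is a set of substructures of probability $1$ any two members of which are elementarily equivalent).
   Context: Structures are $\Upsilon$-structures, sentences are first-order. A substructure is the induced substructure on a subset of elements. The Gaifman graph $[X]$ has the elements of $X$ as vertices, distinct elements being adjacent iff they occur together in a tuple satisfying a relation of $X$. $X$ is connected if $[X]$ has exactly one connected component, and has bounded degree if the vertex degrees of $[X]$ are finite and uniformly bounded. Two substructures of $X$ are disjoint if they have no common element and there are no edges of $[X]$ between them. $X$ has the duplicate substructure property if for every finite substructure there is a disjoint isomorphic substructure. A substructure of a structure $Y$ is closed (in $Y$) if its element set is a union of connected components of $[Y]$. The theory $T$: let $\mathcal{C}$ be the collection of all structures isomorphic to finite substructures of $X$, and let $\mathcal{A}$ be a set of representatives for the isomorphism classes of all finite structures. For $F\in\mathcal{A}\cap\mathcal{C}$, the sentence $\sigma_F$ says that there is a closed substructure isomorphic to $F$; for $F\in\mathcal{A}\setminus\mathcal{C}$, $\sigma_F$ says that there is no substructure isomorphic to $F$. $T$ is the theory with axioms $\{\sigma_F\mid F\in\mathcal{A}\}$. Random substructures: each element of $X$ is retained independently with probability $p$ (deleted with probability $q=1-p$), and the random substructure is the one supported by the retained elements. Formally, $\mu$ is the probability measure on the $\sigma$-algebra of sets of subsets of $X$ generated by the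 cones, where for disjoint finite $U,V\subseteq X$ the cone of all subsets including $U$ and avoiding $V$ has measure $p^{|U|}q^{|V|}$. *)

(* Defs.v *)
From Stdlib Require Export Relations.Relation_Operators.
From mathcomp Require Export all_boot all_order all_algebra.
From mathcomp Require Export all_classical all_reals all_analysis.

Set Implicit Arguments.
Unset Strict Implicit.
Unset Printing Implicit Defensive.

Local Open Scope classical_set_scope.
Local Open Scope card_scope.

(* Relation symbols of arity 0 are allowed. *)
Record vocabulary := Vocabulary { symbol :> finType; arity : symbol -> nat }.

(* The carrier may be empty: a random substructure can be empty, and so can a
   finite substructure. *)
Record structure (Y : vocabulary) := Structure {
  carrier :> Type;
  holds : forall r : Y, (arity r).-tuple carrier -> Prop }.

Record fin_structure (Y : vocabulary) := FinStructure {
  fsize : nat;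
  fholds : forall r : Y, (arity r).-tuple 'I_fsize -> Prop }.

Definition structure_of_fin (Y : vocabulary) (F : fin_structure Y) :
  structure Y := Structure (@fholds Y F).
Coercion structure_of_fin : fin_structure >-> structure.

Section Structures.
Context {Y : vocabulary}.
Implicit Types M N X : structure Y.

Definition isomorphic M N : Prop :=
  exists2 f : M -> N, bijective f &
    forall (r : Y) (t : (arity r).-tuple M),
      holds t <-> holds (map_tuple f t).

Definition induced M (A : set M) : structure Y :=
  @Structure Y (set_type A)
    (fun r t => holds (map_tuple (fun a : set_type A => val a) t)).

Definition gaifman M (x y : M) : Prop :=
  x <> y /\
  exists (r : Y) (t : (arity r).-tuple M) (i j : 'I_(arity r)),
    [/\ holds t, tnth t i = x & tnth t j = y].

Definition component M (x : M) : set M :=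
  [set y | clos_refl_trans M (@gaifman M) x y].

Definition components M : set (set M) := range (@component M).

Definition connected_structure M : Prop := exists! C : set M, components C.

Definition bounded_degree M : Prop :=
  exists d : nat, forall x : M, [set y | gaifman x y] #<= `I_d.

Definition disjoint_substructures M (A B : set M) : Prop :=
  A `&` B = set0 /\ forall a b, A a -> B b -> ~ gaifman a b.

Definition duplicate_substructure_property M : Prop :=
  forall A : set M, finite_set A ->
    exists2 B : set M, disjoint_substructures A B &
      isomorphic (induced A) (induced B).

Definition closed_substructure M (A : set M) : Prop :=
  exists2 P : set (set M), P `<=` @components M & A = \bigcup_(C in P) C.

(* [formula n] has its free variables in ['I_n]; the quantifier binds variable
   0 and shifts the others. *)
Inductive formula : nat -> Type :=
| Top n : formula n
| Eq n (i j : 'I_n) : formula n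
| Atom n (r : Y) (t : (arity r).-tuple 'I_n) : formula n
| Not n (a : formula n) : formula n
| And n (a b : formula n) : formula n
| Ex n (a : formula n.+1) : formula n.

Definition Bot n : formula n := Not (Top n).
Definition Or n (a b : formula n) : formula n := Not (And (Not a) (Not b)).
Definition Imp n (a b : formula n) : formula n := Or (Not a) b.
Definition All n (a : formula n.+1) : formula n := Not (Ex (Not a)).

Fixpoint sat M n (a : formula n) : n.-tuple M -> Prop :=
  match a with
  | Top n => fun e => True
  | Eq n i j => fun e => tnth e i = tnth e j
  | Atom n r t => fun e => holds (map_tuple (tnth e) t)
  | Not n a => fun e => ~ sat a e
  | And n a b => fun e => sat a e /\ sat b e
  | Ex n a => fun e => exists x : M, sat a [tuple of x :: e]
  end.

Definition sentence := formula 0.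

Definition satisfies M (a : sentence) : Prop := sat a [tuple of [::] : seq M].

Definition models M (T : set sentence) : Prop :=
  forall a, T a -> satisfies M a.

Definition elementarily_equivalent M N : Prop :=
  forall a : sentence, satisfies M a <-> satisfies N a.

(* Binds the variables [lshift m i]. *)
Fixpoint Exs k m : formula (k + m) -> formula m :=
  match k with
  | 0 => fun a => a
  | k'.+1 => fun a => @Exs k' m (Ex a)
  end.

Definition adjacent m (x y : 'I_m) : formula m :=
  And (Not (Eq x y))
    (\big[@Or m/Bot m]_(r : Y)
     \big[@Or m/Bot m]_(i : 'I_(arity r))
     \big[@Or m/Bot m]_(j : 'I_(arity r))
       Exs (And (Atom [tuple lshift m l | l < arity r])
           (And (Eq (lshift m i) (rshift (arity r) x))
                (Eq (lshift m j) (rshift (arity r) y))))).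

(* The variables [x] enumerate a copy of [F]. *)
Definition diagram (F : fin_structure Y) m (x : 'I_(fsize F) -> 'I_m) :
    formula m :=
  And
    (\big[@And m/Top m]_(i : 'I_(fsize F))
     \big[@And m/Top m]_(j : 'I_(fsize F) | i != j) Not (Eq (x i) (x j)))
    (\big[@And m/Top m]_(r : Y)
     \big[@And m/Top m]_(t : (arity r).-tuple 'I_(fsize F))
       if `[< fholds t >] then Atom (map_tuple x t)
       else Not (Atom (map_tuple x t))).

(* No element outside the range of the variables [x] is adjacent to one of
   them. *)
Definition closed_formula k m (x : 'I_k -> 'I_m) : formula m :=
  All (Imp
    (\big[@And m.+1/Top m.+1]_(i : 'I_k) Not (Eq ord0 (lift ord0 (x i))))
    (\big[@And m.+1/Top m.+1]_(i : 'I_k)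
       Not (adjacent ord0 (lift ord0 (x i))))).

Definition has_closed_copy (F : fin_structure Y) : sentence :=
  Exs (And (diagram (lshift 0)) (closed_formula (@lshift (fsize F) 0))).

Definition has_no_copy (F : fin_structure Y) : sentence :=
  Not (Exs (diagram (@lshift (fsize F) 0))).

Definition in_age X M : Prop :=
  exists2 A : set X, finite_set A & isomorphic M (induced A).

Definition sigma X (F : fin_structure Y) : sentence :=
  if `[< in_age X F >] then has_closed_copy F else has_no_copy F.

Definition representatives (A : set (fin_structure Y)) : Prop :=
  forall M, finite_set [set: M] ->
    exists! F : fin_structure Y, A F /\ isomorphic M F.

Definition almost_sure_theory X (A : set (fin_structure Y)) : set sentence :=
  [set sigma X F | F in A].

End Structures.

Section RandomSubsets.
Variable E : Type.

Definition cone (U V : set E) : set (set E) :=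
  [set S | U `<=` S /\ S `&` V = set0].

Definition cones : set (set (set E)) :=
  [set cone UV.1 UV.2 | UV in
    [set UV : set E * set E |
      [/\ finite_set UV.1, finite_set UV.2 & UV.1 `&` UV.2 = set0]]].

Definition subset_space := g_sigma_algebraType cones.

(* These values determine [mu], since the cones, together with the empty set,
   are closed under intersection. *)
Definition retention_measure (R : realType) (p : R)
    (mu : probability subset_space R) : Prop :=
  forall (U V : set E) (m n : nat),
    U #= `I_m -> V #= `I_n -> U `&` V = set0 ->
    mu (cone U V) = (p ^+ m * (1 - p) ^+ n)%:E%R.

End RandomSubsets.

Section Semantics.
Context {Y : vocabulary}.
Implicit Types M N X : structure Y.

Lemma sat_big_And M n (e : n.-tuple M) (I : finType) (P : pred I)
    (a : I -> @formula Y n) :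
  sat (\big[@And Y n/Top n]_(i | P i) a i) e <-> forall i, P i -> sat (a i) e.
Proof.
have -> : (forall i, P i -> sat (a i) e) <->
    (forall i, i \in index_enum I -> P i -> sat (a i) e).
  by split=> H i; [move=> _; apply: H | apply: H; rewrite mem_index_enum].
elim: (index_enum I) => [|i s IH]; first by rewrite big_nil; split.
rewrite big_cons; case: ifPn => Pi /=.
  split=> [[ai /IH H] j|H].
    by rewrite inE => /orP[/eqP ->//|]; exact: H.
  split; first by apply: H => //; rewrite mem_head.
  by apply/IH => j js; apply: H; rewrite inE js orbT.
split=> [/IH H j|H].
  by rewrite inE => /orP[/eqP ->|]; [rewrite (negbTE Pi)|exact: H].
by apply/IH => j js; apply: H; rewrite inE js orbT.
Qed.

Lemma sat_Or M n (e : n.-tuple M) (a b : @formula Y n) :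
  sat (Or a b) e <-> sat a e \/ sat b e.
Proof. by rewrite /= -not_orE notK. Qed.

Lemma sat_Imp M n (e : n.-tuple M) (a b : @formula Y n) :
  sat (Imp a b) e <-> (sat a e -> sat b e).
Proof. by rewrite sat_Or /= implyE. Qed.

Lemma sat_All M n (e : n.-tuple M) (a : @formula Y n.+1) :
  sat (All a) e <-> forall x : M, sat a [tuple of x :: e].
Proof. by rewrite /= -forallNE; split=> H x; [exact: contrapT|move/(_ (H x))]. Qed.

Lemma sat_big_Or M n (e : n.-tuple M) (I : finType) (a : I -> @formula Y n) :
  sat (\big[@Or Y n/Bot n]_(i : I) a i) e <-> exists i, sat (a i) e.
Proof.
have -> : (exists i, sat (a i) e) <->
    (exists2 i, i \in index_enum I & sat (a i) e).
  by split=> [[i H]|[i _ H]]; exists i => //; rewrite mem_index_enum.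
elim: (index_enum I) => [|i s IH].
  by rewrite big_nil; split=> [/= H|[]//]; exfalso; exact: H.
rewrite big_cons sat_Or; split.
  by case=> [H|/IH[j js H]]; [exists i; rewrite ?mem_head|exists j; rewrite ?inE ?js ?orbT].
case=> j; rewrite inE => /orP[/eqP ->|js] H; [by left|right].
by apply/IH; exists j.
Qed.

Lemma sat_Exs M k m (e : m.-tuple M) (a : @formula Y (k + m)) :
  sat (Exs a) e <-> exists z : k.-tuple M, sat a [tuple of z ++ e].
Proof.
elim: k a => [|k IH] a /=.
  split=> [H|[z]].
    by exists [tuple]; rewrite (_ : [tuple of _] = e)//; exact: val_inj.
  by rewrite (tuple0 z) (_ : [tuple of _] = e)//; exact: val_inj.
rewrite IH; split=> [[z /= [x H]]|[z H]].
  by exists [tuple of x :: z]; rewrite (_ : [tuple of _] = [tuple of x :: [tuple of z ++ e]])//; exact: val_inj.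
exists [tuple of behead z]; exists (thead z).
rewrite (_ : [tuple of _] = [tuple of z ++ e])//.
by apply: val_inj; rewrite [in RHS](tuple_eta z).
Qed.

Lemma sat_adjacent M m (e : m.-tuple M) (x y : 'I_m) :
  sat (@adjacent Y m x y) e <-> gaifman (tnth e x) (tnth e y).
Proof.
rewrite /adjacent /gaifman.
set a := \big[_/_]_r _.
suff -> : (exists (r : Y) (t : (arity r).-tuple M) (i j : 'I_(arity r)),
    [/\ holds t, tnth t i = tnth e x & tnth t j = tnth e y]) <-> sat a e by [].
rewrite sat_big_Or; split.
  case=> r [t [i [j [h hi hj]]]]; exists r.
  apply/sat_big_Or; exists i; apply/sat_big_Or; exists j; apply/sat_Exs.
  exists t => /=; rewrite !tnth_lshift !tnth_rshift; split=> //.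
  rewrite (_ : map_tuple _ _ = t)//; apply: eq_from_tnth => l.
  by rewrite tnth_map tnth_mktuple tnth_lshift.
case=> r /sat_big_Or[i /sat_big_Or[j /sat_Exs[t /=]]].
rewrite !tnth_lshift !tnth_rshift => -[h [hi hj]].
exists r, t, i, j; split=> //.
rewrite (_ : map_tuple _ _ = t) in h => //; apply: eq_from_tnth => l.
by rewrite tnth_map tnth_mktuple tnth_lshift.
Qed.

Lemma sat_diagram M (F : fin_structure Y) m (x : 'I_(fsize F) -> 'I_m)
    (e : m.-tuple M) :
  sat (diagram x) e <->
  injective (tnth e \o x) /\
  forall (r : Y) (t : (arity r).-tuple 'I_(fsize F)),
    fholds t <-> holds (map_tuple (tnth e \o x) t).
Proof.
rewrite /diagram /=.
have mapE (r : Y) (t : (arity r).-tuple 'I_(fsize F)) :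
    map_tuple (tnth e) (map_tuple x t) = map_tuple (tnth e \o x) t.
  by apply: eq_from_tnth => l; rewrite !tnth_map.
split=> -[/= Hi Hr]; split.
- move=> i j /= eij; apply/eqP; apply: contrapT => /negP nij.
  by move/sat_big_And: Hi => /(_ i isT)/sat_big_And/(_ j nij).
- move=> r t; move/sat_big_And: Hr => /(_ r isT)/sat_big_And/(_ t isT).
  by case: asboolP => /= h; rewrite mapE.
- apply/sat_big_And => i _; apply/sat_big_And => j nij /= eij.
  by move/eqP: nij; apply; exact: Hi.
- apply/sat_big_And => r _; apply/sat_big_And => t _.
  by case: asboolP => h /=; rewrite mapE; [apply/Hr|move/Hr].
Qed.

Lemma closed_substructureP M (A : set M) :
  closed_substructure A <-> forall a b, A a -> gaifman b a -> A b.
Proof.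
have gsym (a b : M) : gaifman a b -> gaifman b a.
  by case=> n [r [t [i [j [h hi hj]]]]]; split; [exact/nesym|exists r, t, j, i].
split=> [[P PC ->] a b [C PC' Ca] g|H].
  exists C => //; have [x _ Cx] := PC _ PC'; rewrite -Cx in Ca *.
  apply: rt_trans Ca _; apply: rt_step; exact: gsym.
have H' (a b : M) : clos_refl_trans M (@gaifman Y M) a b -> A a -> A b.
  elim=> {a b} [a b g Aa|//|a b c _ H1 _ H2 /H1/H2//].
  by apply: H Aa _; exact: gsym.
exists [set component a | a in A]; first by move=> C [a _ <-]; exists a.
apply/seteqP; split=> [a Aa|b [C [a Aa <-]]]; last by move=> /H'; apply.
by exists (component a); [exists a|exact: rt_refl].
Qed.

Lemma copyP M (F : fin_structure Y) (A : set M) :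
  isomorphic F (induced A) <->
  exists z : (fsize F).-tuple M,
    [/\ A = range (tnth z), injective (tnth z) &
      forall (r : Y) (t : (arity r).-tuple 'I_(fsize F)),
        fholds t <-> holds (map_tuple (tnth z) t)].
Proof.
split=> [[f [g fK gK] fh]|[z [-> zi zh]]].
  exists [tuple val (f i) | i < fsize F].
  have zE : tnth [tuple val (f i) | i < fsize F] = val \o f.
    by apply/funext => i; rewrite tnth_mktuple.
  rewrite zE; split.
  - apply/seteqP; split=> [a /mem_set Aa|_ [i _ <-] /=].
      by exists (g (SigSub Aa)) => //=; rewrite gK.
    exact/set_mem/valP.
  - by apply: inj_comp; [exact: val_inj|exact: can_inj fK].
  - move=> r t; apply: (iff_trans (fh r t)) => /=.
    rewrite (_ : map_tuple _ (map_tuple f t) = map_tuple (val \o f) t)//.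
    by apply: eq_from_tnth => l; rewrite !tnth_map.
have Az i : tnth z i \in range (tnth z) by apply/mem_set; exists i.
pose f (i : F) : induced (range (tnth z)) := SigSub (Az i).
have Ag (a : induced (range (tnth z))) : exists i, tnth z i = val a.
  by case: a => a /= /set_mem[i _ <-]; exists i.
exists f.
  exists (fun a => sval (cid (Ag a))) => [i|a].
    by case: cid => j /= /zi.
  by apply: val_inj => /=; case: cid.
move=> r t; apply: (iff_trans (zh r t)) => /=.
rewrite (_ : map_tuple _ (map_tuple f t) = map_tuple (tnth z) t)//.
by apply: eq_from_tnth => l; rewrite !tnth_map.
Qed.

Let tnth_cat0 M k (z : k.-tuple M) :
  tnth [tuple of z ++ ([tuple of [::] : seq M])] \o lshift 0 = tnth z.
Proof. by apply/funext => i /=; rewrite tnth_lshift. Qed.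

Lemma satisfies_has_no_copy M (F : fin_structure Y) :
  satisfies M (has_no_copy F) <-> ~ exists A : set M, isomorphic F (induced A).
Proof.
rewrite /satisfies /=; split=> H; apply: contra_not H.
  case=> A /copyP[z [_ zi zh]]; apply/sat_Exs; exists z.
  by apply/sat_diagram; rewrite tnth_cat0.
move=> /sat_Exs[z /sat_diagram]; rewrite tnth_cat0 => -[zi zh].
by exists (range (tnth z)); apply/copyP; exists z.
Qed.

Lemma satisfies_has_closed_copy M (F : fin_structure Y) :
  satisfies M (has_closed_copy F) <->
  exists2 A : set M, closed_substructure A & isomorphic F (induced A).
Proof.
have closedE (z : (fsize F).-tuple M) :
    sat (closed_formula (@lshift (fsize F) 0))
      [tuple of z ++ ([tuple of [::] : seq M])] <->
    closed_substructure (range (tnth z)).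
  have E0 y (e : (fsize F + 0).-tuple M) : tnth [tuple of y :: e] ord0 = y.
    by [].
  have ES y (i : 'I_(fsize F)) : tnth [tuple of y ::
      [tuple of z ++ ([tuple of [::] : seq M])]] (lift ord0 (lshift 0 i))
      = tnth z i.
    by rewrite tnthS tnth_lshift.
  rewrite closed_substructureP sat_All; split.
    move=> H _ b [i _ <-] g; apply: contrapT => nb.
    have /sat_Imp/(_ _)/sat_big_And := H b.
    move=> /(_ _ i isT); apply; last by apply/sat_adjacent; rewrite E0 ES.
    apply/sat_big_And => j _ /=; rewrite E0 ES => bj.
    by apply: nb; exists j.
  move=> H y; apply/sat_Imp => /sat_big_And Hy; apply/sat_big_And => i _ /=.
  move=> /sat_adjacent; rewrite E0 ES => g.
  have [j _ yj] := H (tnth z i) y (ex_intro2 _ _ i I erefl) g.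
  by apply: (Hy j isT) => /=; rewrite E0 ES.
rewrite /satisfies /has_closed_copy sat_Exs; split.
  case=> z /= [/sat_diagram]; rewrite tnth_cat0 => -[zi zh] /closedE zc.
  by exists (range (tnth z)) => //; apply/copyP; exists z.
case=> A Ac /copyP[z [Az zi zh]]; exists z; split.
  by apply/sat_diagram; rewrite tnth_cat0.
by apply/closedE; rewrite -Az.
Qed.

Lemma isomorphic_refl M : isomorphic M M.
Proof.
exists id; first by exists id.
by move=> r t; rewrite (_ : map_tuple id t = t)//; apply: val_inj; rewrite /= map_id.
Qed.

Lemma isomorphic_sym M N : isomorphic M N -> isomorphic N M.
Proof.
case=> f [g fK gK] fh; exists g; first by exists f.
move=> r t; apply: iff_sym; apply: (iff_trans (fh r _)).
rewrite (_ : map_tuple f _ = t)//.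
by apply: eq_from_tnth => l; rewrite !tnth_map gK.
Qed.

Lemma isomorphic_trans M N X :
  isomorphic M N -> isomorphic N X -> isomorphic M X.
Proof.
case=> f bf fh [g bg gh]; exists (g \o f); first exact: bij_comp.
move=> r t; apply: (iff_trans (fh r t)); apply: (iff_trans (gh r _)).
rewrite (_ : map_tuple g _ = map_tuple (g \o f) t)//.
by apply: eq_from_tnth => l; rewrite !tnth_map.
Qed.

Lemma finite_isomorphic M : finite_set [set: M] ->
  exists F : fin_structure Y, isomorphic M F.
Proof.
case/finite_setP => n /card_set_bijP[f [ff fi fs]].
have hP (i : 'I_n) : exists x, f x = i.
  by have [x _ xi] := fs i (ltn_ord i); exists x.
pose h i := sval (cid (hP i)).
have hK i : f (h i) = i := svalP (cid (hP i)).
pose F := @FinStructure Y n (fun r t => holds (map_tuple h t)).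
exists F; apply: isomorphic_sym; exists h; last by [].
exists (fun x => Ordinal (ff x I)) => [i|x]; first by apply: val_inj; exact: hK.
by apply: fi; rewrite ?inE//; exact: hK.
Qed.

Lemma representatives_exist : exists A, @representatives Y A.
Proof.
pose T : choiceType := {classic fin_structure Y}.
pose F0 : T := @FinStructure Y 0 (fun _ _ => True).
pose rep (F : fin_structure Y) : fin_structure Y :=
  xget F0 [set G : T | isomorphic F (G : fin_structure Y)].
have repP (F : fin_structure Y) : isomorphic F (rep F).
  exact: (@xgetPex T F0 [set G : T | isomorphic F (G : fin_structure Y)]
           (ex_intro _ F (isomorphic_refl F))).
have repE (F G : fin_structure Y) : isomorphic F G -> rep F = rep G.
  move=> FG; rewrite /rep; congr (xget F0 _); apply/seteqP; split=> H /= h.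
    exact: isomorphic_trans (isomorphic_sym FG) h.
  exact: isomorphic_trans FG h.
exists [set F | F = rep F] => M /finite_isomorphic[G MG].
exists (rep G); split.
  by split; [exact/repE/repP|exact: isomorphic_trans MG (repP G)].
move=> F [/= FE MF]; rewrite FE; apply: repE.
exact: isomorphic_trans (isomorphic_sym MG) MF.
Qed.

End Semantics.

(* Main.v *)
(* Almost surely a random substructure contains, for every finite substructure
   of X and every finite V, a closed copy of it that avoids V: by duplication X
   has infinitely many copies whose neighbourhoods are pairwise disjoint, the
   events that a copy is retained and its neighbours are deleted are
   independent, and by bounded degree their probabilities are bounded away
   from 0. Such a substructure is a model of T. Two of them are elementarily
   equivalent by a back-and-forth argument on isomorphisms between balls around
   tuples: a new element far from the tuple is matched by a closed copy of its
   ball. The events are measurable because X, being connected and locally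
   finite, is countable. *)
Require Import Defs.
From mathcomp Require Import zify ring lra.
Import Order.TTheory GRing.Theory Num.Theory.
Import numFieldNormedType.Exports.
Local Open Scope classical_set_scope.

Local Notation inclusion S := (fun x : set_type S => val x).

(** * Back-and-forth between structures that are rich over each other *)

Section ElementaryEquivalence.
Set Implicit Arguments.
Unset Strict Implicit.
Context {Y : vocabulary}.
Implicit Types M N : structure Y.

Lemma gaifman_sym M (x y : M) : gaifman x y -> gaifman y x.
Proof.
by case=> n [r [t [i [j [h hi hj]]]]]; split; [exact/nesym|exists r, t, j, i].
Qed.

(** Distance at most [n] in the Gaifman graph: the case [z = y] lets a walk pause. *)
Fixpoint within M (n : nat) (x y : M) : Prop :=
  if n is n'.+1 then
    exists2 z, within n' x z & z = y \/ gaifman z y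
  else x = y.

Lemma withinxx M n (x : M) : within n x x.
Proof. by elim: n => //= n IH; exists x => //; left. Qed.

Lemma within_trans M m n (x y z : M) :
  within m x y -> within n y z -> within (m + n) x z.
Proof.
move=> xy; elim: n z => [z <-|n IH z [w yw wz]]; first by rewrite addn0.
by rewrite addnS; exists w => //; exact: IH.
Qed.

Lemma within1 M (x y : M) : x = y \/ gaifman x y -> within 1 x y.
Proof. by move=> xy; exists x. Qed.

Lemma within_sym M n (x y : M) : within n x y -> within n y x.
Proof.
elim: n y => [y ->//|n IH y [w /IH xw wy]].
rewrite -add1n; apply: within_trans xw; apply: within1.
by case: wy => [->|/gaifman_sym]; [left|right].
Qed.

Lemma within_le M m n (x y : M) : (m <= n)%N -> within m x y -> within n x y.
Proof.
by move=> /subnKC <- xy; apply: within_trans xy _; exact: withinxx.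
Qed.

Lemma within_holds M n (x : M) (r : Y) (t : (arity r).-tuple M) i j :
  holds t -> within n x (tnth t i) -> within n.+1 x (tnth t j).
Proof.
move=> ht xt; exists (tnth t i) => //.
have [->|ne] := pselect (tnth t i = tnth t j); first by left.
by right; split=> //; exists r, t, i, j.
Qed.

Definition locally_finite M := forall x : M, finite_set [set y | gaifman x y].

Lemma finite_within M n (x : M) :
  locally_finite M -> finite_set [set y | within n x y].
Proof.
move=> lf; elim: n => [|n IH] /=.
  by rewrite (_ : [set y | _] = [set x]);
    [exact: finite_set1|apply/seteqP; split].
rewrite (_ : [set y | _] =
    \bigcup_(z in [set z | within n x z]) (z |` [set y | gaifman z y])).
  by apply: bigcup_finite => // z _; rewrite finite_setU.
apply/seteqP; split=> y [z xz].
  by case=> [<-|zy]; exists z => //; [left|right].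
by case=> [->|zy]; exists z => //; [left|right].
Qed.

(** A relation instead of a partial function, which makes converses and unions immediate; its domain
    consists of the points that have a partner. *)
Definition partial_iso M N (P : M -> N -> Prop) : Prop :=
  (forall x x' y y', P x y -> P x' y' -> (x = x' <-> y = y')) /\
  (forall (r : Y) (t : (arity r).-tuple M) (t' : (arity r).-tuple N),
     (forall i, P (tnth t i) (tnth t' i)) -> (holds t <-> holds t')).

Lemma partial_iso_converse M N (P : M -> N -> Prop) :
  partial_iso P -> partial_iso (fun y x => P x y).
Proof.
case=> Pf Ph; split=> [x x' y y' h h'|r t t' h]; apply: iff_sym.
  exact: Pf.
exact: Ph.
Qed.

Lemma tuple_choice n (T : Type) (P : 'I_n -> T -> Prop) :
  (forall i, exists x, P i x) ->
  exists t : n.-tuple T, forall i, P i (tnth t i).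
Proof.
move=> H; exists (mktuple (fun i => sval (cid (H i)))) => i.
by rewrite tnth_mktuple; exact: (svalP (cid (H i))).
Qed.

(** A tuple witnessing the last edge of a walk stays within one step of the penultimate vertex,
    hence in the domain, and its partners witness the matching edge in [N]. *)
Lemma partial_iso_within M N (P : M -> N -> Prop) n x x' y y' :
  partial_iso P -> (forall z, within n x z -> exists z', P z z') ->
  P x y -> P x' y' -> within n x x' -> within n y y'.
Proof.
case=> Pf Ph; elim: n x' y' => [|n IH] x' y' dP Pxy Px'y'.
  by move=> /= xx'; apply/(Pf _ _ _ _ Pxy Px'y').
case=> w xw wx'.
have [v Pwv] : exists v, P w v.
  by apply: dP; apply: within_le xw; lia.
have yv : within n y v.
  by apply: IH Pxy Pwv xw => z xz; apply: dP; apply: within_le xz; lia.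
exists v => //; have [wE|nwx'] := pselect (w = x').
  by left; apply/(Pf _ _ _ _ Pwv Px'y').
case: wx' => // -[_ [r [t [i [j [ht ti tj]]]]]]; right.
split; first by move=> vE; apply: nwx'; apply/(Pf _ _ _ _ Pwv Px'y').
have [t' Ptt'] : exists t' : (arity r).-tuple N,
    forall l, P (tnth t l) (tnth t' l).
  apply: (tuple_choice (P := fun l => P (tnth t l))) => l.
  by apply: dP; apply: (@within_holds _ _ _ _ _ i l ht); rewrite ti.
exists r, t', i, j; split; first exact/(Ph _ _ _ Ptt').
- by apply/(Pf _ _ _ _ (Ptt' i) Pwv).
- by apply/(Pf _ _ _ _ (Ptt' j) Px'y').
Qed.

Lemma partial_iso_sub M N (P Q : M -> N -> Prop) :
  (forall x y, P x y -> Q x y) -> partial_iso Q -> partial_iso P.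
Proof.
move=> PQ [Qf Qh]; split=> [x x' y y' /PQ ? /PQ|r t t' tt']; first exact: Qf.
by apply: Qh => i; exact: PQ.
Qed.

(** Entries of a tuple in a relation are pairwise equal or adjacent, so separated domains leave no
    tuple that mixes [P] and [Q]. *)
Lemma union_holds M N (P Q : M -> N -> Prop) (r : Y)
    (t : (arity r).-tuple M) (t' : (arity r).-tuple N) :
  partial_iso P -> partial_iso Q ->
  (forall x x' y y', P x y -> Q x' y' -> ~ within 1 x x') ->
  (forall i, P (tnth t i) (tnth t' i) \/ Q (tnth t i) (tnth t' i)) ->
  holds t -> holds t'.
Proof.
move=> [_ Ph] [_ Qh] PQ tt' ht.
have [[i Qi]|nQ] := pselect (exists i, Q (tnth t i) (tnth t' i)).
  apply/(Qh _ t t') => // j; case: (tt' j) => // Pj; exfalso.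
  apply: (PQ _ _ _ _ Pj Qi); exact: (@within_holds _ 0 _ _ _ j i ht).
apply/(Ph _ t t') => // j; case: (tt' j) => // Qj; exfalso.
by apply: nQ; exists j.
Qed.

Lemma partial_iso_union M N (P Q : M -> N -> Prop) :
  partial_iso P -> partial_iso Q ->
  (forall x x' y y', P x y -> Q x' y' -> ~ within 1 x x' /\ ~ within 1 y y') ->
  partial_iso (fun x y => P x y \/ Q x y).
Proof.
move=> Pi Qi PQ; split=> [x x' y y' [Pxy|Qxy] [Pxy'|Qxy']|r t t' tt'].
- by have [Pf _] := Pi; exact: Pf.
- have [nx ny] := PQ _ _ _ _ Pxy Qxy'.
  by split=> [xx'|yy']; [case: nx|case: ny]; apply: within1; left.
- have [nx ny] := PQ _ _ _ _ Pxy' Qxy.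
  by split=> [xx'|yy']; [case: nx|case: ny]; apply: within1; left.
- by have [Qf _] := Qi; exact: Qf.
split.
  apply: union_holds Pi Qi _ tt' => x x' y y' Pxy Qxy.
  by have [] := PQ _ _ _ _ Pxy Qxy.
apply: union_holds (partial_iso_converse Pi) (partial_iso_converse Qi) _ tt'.
by move=> y y' x x' Pxy Qxy; have [] := PQ _ _ _ _ Pxy Qxy.
Qed.

Definition same_type M N k (z : k.-tuple M) (w : k.-tuple N) : Prop :=
  (forall i j, tnth z i = tnth z j <-> tnth w i = tnth w j) /\
  (forall (r : Y) (t : (arity r).-tuple 'I_k),
     holds (map_tuple (tnth z) t) <-> holds (map_tuple (tnth w) t)).

Lemma same_type_partial_iso M N k (z : k.-tuple M) (w : k.-tuple N) :
  same_type z w ->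
  partial_iso (fun x y => exists2 i, tnth z i = x & tnth w i = y).
Proof.
case=> zw zwh; split=> [x x' y y' [i <- <-] [j <- <-]|r t t' tt'].
  exact: zw.
(* One index per position presents [t] and [t'] as images of the same index tuple [s]. *)
have [s sP] := tuple_choice (fun l => let: ex_intro2 i p q := tt' l in
  ex_intro (fun i => tnth z i = tnth t l /\ tnth w i = tnth t' l) i (conj p q)).
rewrite (_ : t = map_tuple (tnth z) s).
  rewrite (_ : t' = map_tuple (tnth w) s) //.
  by apply: eq_from_tnth => l; rewrite tnth_map; case: (sP l).
by apply: eq_from_tnth => l; rewrite tnth_map; case: (sP l).
Qed.

(** The last clause makes the range of [w] closed in [N]. With [M] equal to [X] this yields models
    of the theory; with [M] another random substructure it drives the back-and-forth. *)
Definition rich M N : Prop :=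
  forall k (z : k.-tuple M) (V : set N), finite_set V ->
  exists w : k.-tuple N,
    [/\ same_type z w, forall i, ~ V (tnth w i) &
        forall i y, gaifman (tnth w i) y -> exists j, tnth w j = y].

(** [P] may reach beyond the balls, so the same [P] serves every smaller radius. *)
Definition ball_equiv M N n (r : nat) (e : n.-tuple M) (e' : n.-tuple N) :=
  exists P : M -> N -> Prop,
    [/\ partial_iso P, forall i, P (tnth e i) (tnth e' i),
        forall i x, within r (tnth e i) x -> exists y, P x y &
        forall i y, within r (tnth e' i) y -> exists x, P x y].

Lemma ball_equiv_sym M N n r (e : n.-tuple M) (e' : n.-tuple N) :
  ball_equiv r e e' -> ball_equiv r e' e.
Proof.
case=> P [Pi Pe Pl Pr]; exists (fun y x => P x y); split=> //.
exact: partial_iso_converse.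
Qed.

Lemma ball_equiv_le M N n r s (e : n.-tuple M) (e' : n.-tuple N) :
  (r <= s)%N -> ball_equiv s e e' -> ball_equiv r e e'.
Proof.
move=> rs [P [Pi Pe Pl Pr]]; exists P; split=> // i x /(within_le rs).
  exact: Pl.
exact: Pr.
Qed.

Lemma tnth_cons_ord0 (T : Type) n (x : T) (e : n.-tuple T) :
  tnth [tuple of x :: e] ord0 = x.
Proof. by []. Qed.

Lemma finite_set_tuple (T : Type) (A : set T) :
  finite_set A -> exists k (z : k.-tuple T), A = range (tnth z).
Proof.
move=> /(@finite_seqP {classic T})[s ->].
exists (size s), (in_tuple s); apply/seteqP; split=> x /=.
  by move=> /(@tnthP _ {classic T} (in_tuple s))[i ->]; exists i.
by case=> i _ <-; exact: (@mem_tnth _ {classic T}).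
Qed.

(* A new point within distance 2r+1 of [e] is matched by the given partial
   isomorphism. Any other point has its r-ball separated from that of [e], so
   richness yields a closed copy of the ball separated from that of [e']. *)
Lemma ball_equiv_extend M N n r (e : n.-tuple M) (e' : n.-tuple N) x :
  locally_finite M -> locally_finite N -> rich M N ->
  ball_equiv (3 * r + 1) e e' ->
  exists y, ball_equiv r [tuple of x :: e] [tuple of y :: e'].
Proof.
move=> fM fN MN [P [Pi Pe Pl Pr]].
have [[i0 xi0]|far] := pselect (exists i, within (2 * r + 1) (tnth e i) x).
  have [y Pxy] : exists y, P x y by apply: (Pl i0); apply: within_le xi0; lia.
  have yi0 : within (2 * r + 1) (tnth e' i0) y.
    apply: partial_iso_within Pi _ (Pe i0) Pxy xi0 => z iz.
    by apply: (Pl i0); apply: within_le iz; lia.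
  exists y; exists P; split=> //.
  - by move=> i; case: (unliftP ord0 i) => [j|] ->; rewrite ?tnthS.
  - move=> i z; case: (unliftP ord0 i) => [j|] ->;
      rewrite ?tnthS ?tnth_cons_ord0 => iz.
      by apply: (Pl j); apply: within_le iz; lia.
    apply: (Pl i0); apply: within_le (within_trans xi0 iz); lia.
  - move=> i z; case: (unliftP ord0 i) => [j|] ->;
      rewrite ?tnthS ?tnth_cons_ord0 => iz.
      by apply: (Pr j); apply: within_le iz; lia.
    apply: (Pr i0); apply: within_le (within_trans yi0 iz); lia.
have [k [z zE]] := finite_set_tuple (finite_within r x fM).
have zP i : within r x (tnth z i).
  by have : range (tnth z) (tnth z i) by []; rewrite -zE.
pose V := \bigcup_(i in [set: 'I_n]) [set y | within r (tnth e' i) y].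
have Vf : finite_set V.
  by apply: bigcup_finite => // i _; exact: finite_within.
have [w [zw wV wc]] := MN _ z V Vf.
have [i0 zi0] : exists i, tnth z i = x.
  have : range (tnth z) x by rewrite -zE; exact: withinxx.
  by case=> i _ <-; exists i.
(* [P] may also relate points near the new copy, so only its restriction to the [r]-balls is kept.
   The restriction still covers these balls, as [P] preserves distances there. *)
pose P' a b := P a b /\ (exists i, within r (tnth e i) a) /\
  exists i, within r (tnth e' i) b.
pose Q a b := exists2 i, tnth z i = a & tnth w i = b.
have Qi : partial_iso Q := same_type_partial_iso zw.
have P'l i a : within r (tnth e i) a -> exists b, P' a b.
  move=> ia; have [b Pab] : exists b, P a b.
    by apply: (Pl i); apply: within_le ia; lia.
  exists b; split=> //; split; exists i => //.
  apply: partial_iso_within Pi _ (Pe i) Pab ia => c ic.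
  by apply: (Pl i); apply: within_le ic; lia.
have P'r i b : within r (tnth e' i) b -> exists a, P' a b.
  move=> ib; have [a Pab] : exists a, P a b.
    by apply: (Pr i); apply: within_le ib; lia.
  exists a; split=> //; split; exists i => //.
  apply: partial_iso_within (partial_iso_converse Pi) _ (Pe i) Pab ib => c ic.
  by apply: (Pr i); apply: within_le ic; lia.
have P'i : partial_iso P' by apply: partial_iso_sub Pi => a b [].
(* In [M], a step between the two domains would put [x] within [r + 1 + r] of the tuple. In [N], the
   range of [w] is closed and misses [V]. *)
have sep a a' b b' : P' a b -> Q a' b' -> ~ within 1 a a' /\ ~ within 1 b b'.
  move=> [_ [[i ia] [i' ib]]] [j za' wb']; split=> [aa'|[_ <- bb']].
    apply: far; exists i; apply: (within_le (m := r + 1 + r)); first by lia.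
    apply: within_trans (within_trans ia aa') _; apply: within_sym.
    by rewrite -za'.
  suff [j' wb] : exists j', tnth w j' = b.
    by apply: (wV j'); exists i'; rewrite // wb.
  case: bb' => [->|/gaifman_sym]; first by exists j.
  by rewrite -wb' => /wc.
exists (tnth w i0); exists (fun a b => P' a b \/ Q a b); split.
- exact: partial_iso_union.
- move=> i; case: (unliftP ord0 i) => [j|] ->; rewrite ?tnthS ?tnth_cons_ord0.
    left; split=> //; split; exists j; exact: withinxx.
  by right; exists i0.
- move=> i a; case: (unliftP ord0 i) => [j|] ->; rewrite ?tnthS ?tnth_cons_ord0.
    by move=> /P'l[b]; exists b; left.
  move=> xa; have : range (tnth z) a by rewrite -zE.
  by case=> j _ <-; exists (tnth w j); right; exists j.
- move=> i b; case: (unliftP ord0 i) => [j|] ->; rewrite ?tnthS ?tnth_cons_ord0.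
    by move=> /P'r[a]; exists a; left.
  move=> wb; suff [j <-] : exists j, tnth w j = b.
    by exists (tnth z j); right; exists j.
  (* Being closed under adjacency, the range of [w] contains every ball around [tnth w i0]. *)
  elim: (r) b wb => [b <-|m IH b [c /IH[j <-]] []]; first by exists i0.
    by exists j.
  by move/wc.
Qed.

(** A quantifier costs [2 * r + 1] to reach a near witness and [r] more for the ball around it, as
    in [ball_equiv_extend]. *)
Fixpoint radius n (a : @formula Y n) : nat :=
  match a with
  | Top _ => 0
  | Eq _ _ _ => 0
  | Atom _ _ _ => 0
  | Not _ a => radius a
  | And _ a b => maxn (radius a) (radius b)
  | Ex _ a => 3 * radius a + 1
  end.

Lemma sat_ball_equiv M N n (a : @formula Y n)
    (e : n.-tuple M) (e' : n.-tuple N) :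
  locally_finite M -> locally_finite N -> rich M N -> rich N M ->
  ball_equiv (radius a) e e' -> sat a e <-> sat a e'.
Proof.
move=> fM fN MN NM; elim: a e e' => {n}
  [n|n i j|n r t|n a IH|n a IHa b IHb|n a IH] e e' /=.
- by [].
- by case=> P [[Pf _] Pe _ _]; exact: Pf.
- by case=> P [[_ Ph] Pe _ _]; apply: Ph => l; rewrite !tnth_map.
- by move=> /IH[H1 H2]; split=> h /= ?; apply: h; [apply: H2|apply: H1].
- move=> ee'; have /IHa[? ?] := ball_equiv_le (leq_maxl _ _) ee'.
  by have /IHb[? ?] := ball_equiv_le (leq_maxr _ _) ee'; split=> -[]; auto.
- move=> ee'; split=> -[x ax].
    have [y xy] := ball_equiv_extend x fM fN MN ee'.
    by exists y; apply/(IH _ _ xy).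
  have [y xy] := ball_equiv_extend x fN fM NM (ball_equiv_sym ee').
  by exists y; apply/(IH _ _ (ball_equiv_sym xy)).
Qed.

Lemma rich_elementarily_equivalent M N :
  locally_finite M -> locally_finite N -> rich M N -> rich N M ->
  elementarily_equivalent M N.
Proof.
move=> fM fN MN NM a; apply: sat_ball_equiv => //.
(* Richness at the empty tuple makes [M] and [N] agree on the relations of arity 0. *)
pose z : 0.-tuple M := [tuple].
have [w [zw _ _]] := MN _ z set0 (finite_set0 _).
exists (fun x y => exists2 i, tnth z i = x & tnth w i = y).
by split; [exact: same_type_partial_iso|case|case|case].
Qed.

End ElementaryEquivalence.

(** * Events quantified over a countable type *)

Section Countable.
Set Implicit Arguments.
Unset Strict Implicit.
Context d (T : measurableType d) (I : countType).

Lemma measurable_forall (P : I -> T -> Prop) :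
  (forall i, measurable [set x | P i x]) -> measurable [set x | forall i, P i x].
Proof.
move=> mP; rewrite (_ : [set x | _] = \bigcap_n
    (if @unpickle I n is Some i then [set x | P i x] else setT)).
  by apply: bigcapT_measurable => n; case: unpickle.
apply/seteqP; split=> [x Px n _|x Px i].
  by case: unpickle => //= i; exact: Px.
by have := Px (pickle i) Logic.I; rewrite pickleK.
Qed.

Lemma measurable_exists (P : I -> T -> Prop) :
  (forall i, measurable [set x | P i x]) -> measurable [set x | exists i, P i x].
Proof.
move=> mP; rewrite (_ : [set x | _] = ~` [set x | forall i, ~ P i x]).
  apply: measurableC; apply: measurable_forall => i.
  exact: measurableC (mP i).
apply/seteqP; split=> [x [i Pi] /(_ i)//|x /=].
by move/existsNP=> [i /contrapT]; exists i.
Qed.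

Lemma almost_surely_forall (R : realType) (mu : probability T R)
    (P : I -> T -> Prop) :
  (forall i, measurable [set x | P i x]) ->
  (forall i, mu.-negligible [set x | ~ P i x]) ->
  mu [set x | forall i, P i x] = 1%E.
Proof.
move=> mP P0.
have mF : measurable [set x | forall i, P i x] by exact: measurable_forall.
suff : mu (~` [set x | forall i, P i x]) = 0%E.
  move=> F0; rewrite -[X in mu X]setCK probability_setC ?F0 ?sube0//.
  exact: measurableC.
apply/negligibleP; first exact: measurableC.
apply: (negligibleS (A := \bigcup_n
    (if @unpickle I n is Some i then [set x | ~ P i x] else set0))).
  move=> x /= /existsNP[i nPi]; exists (pickle i) => //.
  by rewrite pickleK.
apply: negligible_bigcup => n; case: unpickle => [i|]; first exact: P0.
exact: negligible_set0.
Qed.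

End Countable.

(** * Measurability of satisfaction in a random substructure *)

Section Satisfaction.
Set Implicit Arguments.
Unset Strict Implicit.
Context {Y : vocabulary}.
Implicit Types M N X : structure Y.

(* Truth in [induced S], stated for all tuples of [X] so that [S] can vary
   with the tuple fixed. *)
Fixpoint sat_in X (S : set X) n (a : @formula Y n) : n.-tuple X -> Prop :=
  match a with
  | Top n => fun e => True
  | Eq n i j => fun e => tnth e i = tnth e j
  | Atom n r t => fun e => holds (map_tuple (tnth e) t)
  | Not n a => fun e => ~ sat_in S a e
  | And n a b => fun e => sat_in S a e /\ sat_in S b e
  | Ex n a => fun e => exists x : X, S x /\ sat_in S a [tuple of x :: e]
  end.

Lemma sat_induced X (S : set X) n (a : @formula Y n) (e : n.-tuple (induced S)) :
  sat a e <-> sat_in S a (map_tuple (inclusion S) e).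
Proof.
elim: a e => {n} [n|n i j|n r t|n a IH|n a IHa b IHb|n a IH] e /=.
- by [].
- by rewrite !tnth_map; split=> [->//|]; exact: val_inj.
- rewrite (_ : map_tuple _ (map_tuple _ _) =
    map_tuple (tnth (map_tuple (inclusion S) e)) t) //.
  by apply: eq_from_tnth => l; rewrite !tnth_map.
- by rewrite IH.
- by rewrite IHa IHb.
- split=> [[x /IH ax]|[x [Sx ax]]].
    exists (val x); split; first exact/set_mem/valP.
    rewrite (_ : [tuple of _] = map_tuple (inclusion S) [tuple of x :: e]) //.
    exact: val_inj.
  exists (SigSub (mem_set Sx)); apply/IH.
  rewrite (_ : map_tuple _ _ = [tuple of x :: map_tuple (inclusion S) e]) //.
  exact: val_inj.
Qed.

Lemma measurable_cone (E : Type) (U V : set E) : finite_set U -> finite_set V ->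
  U `&` V = set0 -> measurable (cone U V : set (subset_space E)).
Proof. by move=> fU fV UV; apply: sub_sigma_algebra; exists (U, V). Qed.

Lemma measurable_mem (E : Type) (x : E) :
  measurable [set S : subset_space E | (S : set E) x].
Proof.
rewrite (_ : mkset _ = cone [set x] set0 :> set (subset_space E)).
  by apply: measurable_cone => //; rewrite setI0.
apply/seteqP; split=> S /=.
  by move=> Sx; split; [move=> _ ->|exact: setI0].
by case=> + _; apply.
Qed.

(** The surjection [u] expresses that [X] is countable and turns each quantifier into a countable
    union of events. *)
Lemma measurable_sat_in (I : countType) X (u : I -> X) n (a : @formula Y n) e :
  set_surj setT setT u ->
  measurable [set S : subset_space X | sat_in (S : set X) a e].
Proof.
move=> us; elim: a e => {n} [n|n i j|n r t|n a IH|n a IHa b IHb|n a IH] e /=.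
- exact: measurableT.
- by have [h|h] := pselect (tnth e i = tnth e j);
    [rewrite (_ : [set _ | _] = setT)|rewrite (_ : [set _ | _] = set0)] => //;
    apply/seteqP; split.
- by have [h|h] := pselect (holds (map_tuple (tnth e) t));
    [rewrite (_ : [set _ | _] = setT)|rewrite (_ : [set _ | _] = set0)] => //;
    apply/seteqP; split.
- exact: measurableC (IH e).
- exact: measurableI (IHa e) (IHb e).
- rewrite (_ : [set _ | _] = [set S : subset_space X | exists i,
      (S : set X) (u i) /\ sat_in (S : set X) a [tuple of u i :: e]]).
    apply: measurable_exists => i; apply: measurableI (IH _).
    exact: measurable_mem.
  apply/seteqP; split=> S [] => [x|i H]; last by exists (u i).
  by have [i _ <-] := us x Logic.I; exists i.
Qed.

Lemma measurable_satisfies (I : countType) X (u : I -> X) (a : sentence) :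
  set_surj setT setT u ->
  measurable [set S : subset_space X | satisfies (induced (S : set X)) a].
Proof.
move=> us; rewrite (_ : [set _ | _] = [set S | sat_in (S : set X) a [tuple]]).
  exact: measurable_sat_in us.
apply/seteqP; split=> S /=; rewrite /satisfies sat_induced;
  rewrite (_ : map_tuple _ _ = [tuple]) //; exact: val_inj.
Qed.

(** Boolean tables over a finite vocabulary form a countable type, so the axioms of the theory
    become a countable family. *)
Definition fin_structure_of_code
    (c : {n : nat & {ffun {r : Y & (arity r).-tuple 'I_n} -> bool}}) :
    fin_structure Y :=
  let: existT n g := c in
  FinStructure (fun r t => g (existT _ r t)).

Lemma fin_structure_of_code_surj : set_surj setT setT fin_structure_of_code.
Proof.
case=> n h _; exists (existT _ n
  [ffun c : {r : Y & (arity r).-tuple 'I_n} => `[< h (tag c) (tagged c) >]]) => //=.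
congr FinStructure; apply: functional_extensionality_dep => r; apply/funext => t.
by apply/propext; rewrite ffunE /=; split; [move/asboolP|move=> ?; apply/asboolP].
Qed.

Lemma measurable_models (I : countType) X (u : I -> X) (A : set (fin_structure Y)) :
  set_surj setT setT u ->
  measurable [set S : subset_space X |
    models (induced (S : set X)) (almost_sure_theory X A)].
Proof.
move=> us; rewrite (_ : [set _ | _] = [set S : subset_space X | forall c,
    A (fin_structure_of_code c) ->
    satisfies (induced (S : set X)) (sigma X (fin_structure_of_code c))]).
  apply: measurable_forall => c.
  have [Ac|nAc] := pselect (A (fin_structure_of_code c)).
    rewrite (_ : [set _ | _] = [set S : subset_space X |
      satisfies (induced (S : set X)) (sigma X (fin_structure_of_code c))]).
      exact: measurable_satisfies us.
    by apply/seteqP; split=> S /= H; [exact: H|].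
  by rewrite (_ : [set _ | _] = setT) //; apply/seteqP; split=> // S _ /nAc.
apply/seteqP; split=> S /=.
  by move=> SA c Ac; apply: SA; exists (fin_structure_of_code c).
move=> H _ [F AF <-]; have [c _ cF] := @fin_structure_of_code_surj F Logic.I.
by rewrite -cF in AF *; exact: H.
Qed.

End Satisfaction.

(** * Null events from independent boxes *)

Section Retention.
Set Implicit Arguments.
Unset Strict Implicit.
Local Open Scope ring_scope.
Context (E : Type).
Notation T := {classic E}.

Lemma card_set_uniq (s : seq T) : uniq s -> ([set` s] #= `I_(size s))%card.
Proof.
move=> us; apply/card_set_bijP; exists (index^~ s); split.
- by move=> x /= xs; rewrite index_mem.
- by move=> x y /set_mem /= xs /set_mem /= ys; exact: index_inj.
- case: s us => [|x0 s] us i // ix; exists (nth x0 (x0 :: s) i).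
    exact: mem_nth.
  by rewrite index_uniq.
Qed.

(** Cones given by sequences, whose sizes are the exponents in the measure when the entries are
    distinct. *)
Definition box (st : seq T * seq T) : set (subset_space E) :=
  cone [set` st.1] [set` st.2].

Lemma box_measurable st : uniq (st.1 ++ st.2) -> measurable (box st).
Proof.
rewrite cat_uniq => /and3P[_ /hasPn st12 _].
apply: measurable_cone; [exact: (@finite_seq T)|exact: (@finite_seq T)|].
by apply/seteqP; split=> x //= [xs xt]; have /negP := st12 _ xt; apply.
Qed.

Lemma boxP st (S : set E) :
  box st S <-> (forall x, x \in st.1 -> S x) /\ (forall x, x \in st.2 -> ~ S x).
Proof.
split=> -[sS tS]; split; [exact: sS| |exact: sS|].
  by move=> x xt Sx; have : (S `&` [set` st.2]) x by []; rewrite tS.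
by apply/seteqP; split=> x // [Sx /tS].
Qed.

Lemma boxI st st' : box st `&` box st' = box (st.1 ++ st'.1, st.2 ++ st'.2).
Proof.
apply/seteqP; split=> S.
  move=> [/boxP[sS tS] /boxP[sS' tS']]; apply/boxP; split=> x;
    by rewrite mem_cat => /orP[]; auto.
move=> /boxP[sS tS]; split; apply/boxP; split=> x xst;
  by [apply: sS; rewrite mem_cat xst ?orbT|apply: tS; rewrite mem_cat xst ?orbT].
Qed.

Context (R : realType) (p : R) (mu : probability (subset_space E) R).
Context (mu_p : retention_measure p mu) (p_gt0 : 0 < p) (p_lt1 : p < 1).

Lemma mu_box st : uniq (st.1 ++ st.2) ->
  mu (box st) = (p ^+ size st.1 * (1 - p) ^+ size st.2)%:E.
Proof.
rewrite cat_uniq => /and3P[u1 /hasPn st12 u2].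
apply: mu_p; [exact: card_set_uniq|exact: card_set_uniq|].
by apply/seteqP; split=> x //= [xs xt]; have /negP := st12 _ xt; apply.
Qed.

(* Avoiding finitely many boxes with disjoint supports is independent of every
   box whose support is disjoint from theirs. *)
Lemma avoid_boxes (W : set (seq T * seq T)) (c : R) n :
  (forall st, W st -> uniq (st.1 ++ st.2)) ->
  (forall st, W st -> c <= p ^+ size st.1 * (1 - p) ^+ size st.2) ->
  (forall K : seq T, exists2 st, W st & ~~ has (mem K) (st.1 ++ st.2)) ->
  exists (D : set (subset_space E)) (K : seq T) (g : R),
    [/\ measurable D, (~` \bigcup_(st in W) box st) `<=` D,
        0 <= g <= (1 - c) ^+ n &
        forall st, uniq (st.1 ++ st.2) -> ~~ has (mem K) (st.1 ++ st.2) ->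
          mu (box st `&` D) = (p ^+ size st.1 * (1 - p) ^+ size st.2 * g)%:E].
Proof.
move=> Wu Wc Wfresh; elim: n => [|n [D [K [g [mD DW /andP[g0 gn] Dg]]]]].
  exists setT, [::], 1; split=> //; first by rewrite ler01 expr0 lexx.
  by move=> st ust _; rewrite setIT mulr1 mu_box.
have [st' Wst' st'K] := Wfresh K.
have ust' := Wu _ Wst'.
pose b := p ^+ size st'.1 * (1 - p) ^+ size st'.2.
have b1 : b <= 1.
  have q0 : 0 <= 1 - p by rewrite subr_ge0 ltW.
  have q1 : 1 - p <= 1 by rewrite gerBl ltW.
  by rewrite mulr_ile1 ?exprn_ge0 ?exprn_ile1 ?(ltW p_gt0) ?(ltW p_lt1).
(* Each round removes one more box, adds its support to [K], and multiplies the measure by [1 - b],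
   at most [1 - c]. *)
exists (D `\` box st'), (st'.1 ++ st'.2 ++ K), (g * (1 - b)); split.
- by apply: measurableD => //; exact: box_measurable.
- by move=> S nS; split; [exact: DW|move=> ?; apply: nS; exists st'].
- rewrite mulr_ge0 ?subr_ge0//= exprSr ler_pM ?subr_ge0// lerB//.
  exact: Wc.
- move=> st ust stK.
  have /negP stK1 : ~~ has (mem K) (st.1 ++ st.2).
    apply: contra stK => /hasP[x xst xK]; apply/hasP; exists x => //=.
    by rewrite !mem_cat (xK : x \in K) !orbT.
  have uU : uniq ((st.1 ++ st'.1) ++ (st.2 ++ st'.2)).
    rewrite -(perm_uniq (s1 := (st.1 ++ st.2) ++ (st'.1 ++ st'.2))); last first.
      rewrite -!catA perm_cat2l [X in perm_eq _ X]catA perm_sym.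
      by rewrite -[X in perm_eq X _]catA perm_catCA.
    rewrite cat_uniq ust ust' andbT /=; apply/hasPn => x xst'.
    apply: contra stK => xst; apply/hasP; exists x => //=.
    by rewrite catA mem_cat xst'.
  have mst := box_measurable ust.
  have mst' := box_measurable ust'.
  (* The two boxes meet in a single box whose support is still disjoint from [K], so the induction
     hypothesis applies to it. *)
  have inter : mu (box st `&` D `&` box st') =
      (p ^+ size st.1 * (1 - p) ^+ size st.2 * b * g)%:E.
    rewrite setIAC boxI Dg //=.
      by rewrite !size_cat !exprD /b; congr EFin; ring.
    rewrite -catA !has_cat /= in st'K stK1 *.
    by move: st'K stK1; do 4! case: has.
  have mstD : measurable (box st `&` D) by exact: measurableI.
  have muD := Dg st ust (introN idP stK1).
  rewrite setIDA; have -> : mu ((box st `&` D) `\` box st') =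
      (mu (box st `&` D) - mu (box st `&` D `&` box st'))%E.
    apply: measureD => //.
    exact: le_lt_trans (probability_le1 mu mstD) (ltry 1).
  by rewrite inter muD -EFinB; congr EFin; ring.
Qed.

Lemma measurable_le_expr0 (B : set (subset_space E)) (c : R) :
  measurable B -> 0 < c -> c <= 1 ->
  (forall n, (mu B <= ((1 - c) ^+ n)%:E)%E) ->
  mu B = 0%E.
Proof.
move=> mB c0 c1 Bc; have Bfin := fin_num_measure mu _ mB.
apply/eqP; rewrite eq_le measure_ge0 andbT -(fineK Bfin) lee_fin.
have cv : (1 - c) ^+ n @[n --> \oo] --> (0 : R).
  by apply: cvg_expr; rewrite ger0_norm; lra.
rewrite -(cvg_lim _ cv) //; apply: limr_ge; first by apply/cvg_ex; exists 0.
by apply: nearW => n; rewrite -lee_fin fineK.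
Qed.

(** [W] may be uncountable, so the complement is covered by the measurable intersection of the sets
    [D n], each of measure at most [(1 - c) ^+ n]. *)
Lemma mu_avoid_boxes (W : set (seq T * seq T)) (c : R) :
  0 < c -> c <= 1 ->
  (forall st, W st -> uniq (st.1 ++ st.2)) ->
  (forall st, W st -> c <= p ^+ size st.1 * (1 - p) ^+ size st.2) ->
  (forall K : seq T, exists2 st, W st & ~~ has (mem K) (st.1 ++ st.2)) ->
  mu.-negligible (~` \bigcup_(st in W) box st).
Proof.
move=> c0 c1 Wu Wc Wfresh.
have avoid n := avoid_boxes n Wu Wc Wfresh.
pose D n := sval (cid (avoid n)).
have mD n : measurable (D n) by have [K [g []]] := svalP (cid (avoid n)).
exists (\bigcap_n D n); split.
- exact: bigcapT_measurable.
- apply: (measurable_le_expr0 (c := c)) => // [|n].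
    exact: bigcapT_measurable.
  have [K [g [_ _ /andP[g0 gn] Dg]]] := svalP (cid (avoid n)).
  apply: le_trans (_ : mu (D n) <= _)%E.
    rewrite le_measure ?inE//; first exact: bigcapT_measurable.
    exact: bigcap_inf.
  (* The box with empty support is the whole space, so this reads off the measure of [D n]. *)
  have /= := Dg ([::], [::]) isT isT.
  rewrite !expr0 !mul1r (_ : box _ = setT) ?setTI => [->|].
    by rewrite lee_fin.
  by apply/seteqP; split=> // S _; split=> //; apply/seteqP; split=> x [].
- move=> S nS n _; have [K [g [_ DW _ _]]] := svalP (cid (avoid n)).
  exact: DW.
Qed.

End Retention.

(** * Richness of random substructures *)

Section Copies.
Set Implicit Arguments.
Unset Strict Implicit.
Context {Y : vocabulary}.
Implicit Types M N X : structure Y.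

Lemma same_type_sym M N k (z : k.-tuple M) (w : k.-tuple N) :
  same_type z w -> same_type w z.
Proof. by case=> zw zwh; split=> *; apply: iff_sym. Qed.

Lemma same_type_trans M N X k (z : k.-tuple M) (w : k.-tuple N) (v : k.-tuple X) :
  same_type z w -> same_type w v -> same_type z v.
Proof.
case=> zw zwh [wv wvh]; split=> *.
  exact: iff_trans (zw _ _) (wv _ _).
exact: iff_trans (zwh _ _) (wvh _ _).
Qed.

Lemma same_type_map M N k (f : M -> N) (z : k.-tuple M) :
  injective f ->
  (forall (r : Y) (t : (arity r).-tuple M), holds t <-> holds (map_tuple f t)) ->
  same_type z (map_tuple f z).
Proof.
move=> fi fh; split=> [i j|r t].
  by rewrite !tnth_map; split=> [->//|/fi].
rewrite (_ : map_tuple (tnth (map_tuple f z)) t =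
  map_tuple f (map_tuple (tnth z) t)); first exact: fh.
by apply: eq_from_tnth => l; rewrite !tnth_map.
Qed.

Lemma same_type_val X (S : set X) k (z : k.-tuple (induced S)) :
  same_type z (map_tuple (inclusion S) z : k.-tuple X).
Proof. by apply: same_type_map; first exact: val_inj. Qed.

Lemma lift_tuple X (S : set X) k (w : k.-tuple X) :
  (forall i, S (tnth w i)) ->
  exists w' : k.-tuple (induced S), map_tuple (inclusion S) w' = w.
Proof.
move=> wS; exists (mktuple (fun i => SigSub (mem_set (wS i)))).
by apply: eq_from_tnth => i; rewrite tnth_map tnth_mktuple.
Qed.

(** The converse can fail: an edge of [X] may come only from tuples with an entry outside [S]. *)
Lemma gaifman_val X (S : set X) (x y : induced S) :
  gaifman x y -> gaifman (val (x : set_type S)) (val (y : set_type S)).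
Proof.
case=> xy [r [t [i [j [ht ti tj]]]]]; split; first by move/val_inj.
exists r, (map_tuple (inclusion S) t), i, j.
by split; rewrite ?tnth_map ?ti ?tj.
Qed.

Lemma locally_finite_induced X (S : set X) :
  locally_finite X -> locally_finite (induced S).
Proof.
move=> fX x; apply: (sub_finite_set (B :=
    inclusion S @^-1` [set y | gaifman (val (x : set_type S)) y])).
  by move=> y /gaifman_val.
by apply: finite_preimage => // y z _ _; exact: val_inj.
Qed.

Lemma rich_induced X (S : set X) N : rich X N -> rich (induced S) N.
Proof.
move=> XN k z V Vf.
have [w [zw wV wc]] := XN _ (map_tuple (inclusion S) z) V Vf.
by exists w; split=> //; apply: same_type_trans zw; exact: same_type_val.
Qed.

(** Richness supplies the closed copies; a structure outside the age of [X] has no copy because a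
    substructure of [induced S] is one of [X]. *)
Lemma rich_models X (S : set X) (A : set (fin_structure Y)) :
  rich X (induced S) -> models (induced S) (almost_sure_theory X A).
Proof.
move=> XS _ [F _ <-]; rewrite /sigma; case: asboolP => [[A0 _ /copyP]|noF].
  move=> [z [_ zi zh]]; have [w [[zw zwh] _ wc]] := XS _ z set0 (finite_set0 _).
  apply/satisfies_has_closed_copy; exists (range (tnth w)).
    apply/closed_substructureP => _ b [i _ <-] /gaifman_sym /wc[j <-].
    by exists j.
  apply/copyP; exists w; split=> //; first by move=> i j /zw/zi.
  by move=> r t; apply: iff_trans (zh r t) (zwh r t).
apply/satisfies_has_no_copy => -[B /copyP[z [_ zi zh]]]; apply: noF.
pose z' : (fsize F).-tuple X := map_tuple (inclusion S) z.
have [zz' zzh'] := same_type_val z.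
exists (range (tnth z')); first exact: finite_image.
apply/copyP; exists z'; split=> //; first by move=> i j /zz'/zi.
by move=> r t; apply: iff_trans (zh r t) (zzh' r t).
Qed.

Definition neighbours X (nb : X -> seq {classic X}) d : Prop :=
  forall x, size (nb x) <= d /\ forall y, y \in nb x <-> gaifman x y.

Lemma bounded_degree_neighbours X :
  bounded_degree X -> exists d nb, @neighbours X nb d.
Proof.
case=> d dX; exists d.
have nbP x : exists s : seq {classic X},
    size s <= d /\ forall y, y \in s <-> gaifman x y.
  have /(@finite_seqP {classic X})[s sE] : finite_set [set y | gaifman x y].
    by apply/finite_set_leP; exists d.
  exists (undup s); split; last first.
    move=> y; rewrite mem_undup.
    by have /seteqP[h1 h2] := sE; split=> [/h2|/h1].
  rewrite -card_le_II -(card_le_eql (card_set_uniq (undup_uniq s))).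
  apply: card_le_trans (dX x); apply: subset_card_le => y /=.
  by rewrite mem_undup; have /seteqP[_ h2] := sE; exact: h2.
by exists (fun x => sval (cid (nbP x))) => x; exact: (svalP (cid (nbP x))).
Qed.

(** Every vertex ends a walk from [x0], coded by the positions chosen in the successive neighbour
    lists. *)
Lemma connected_countable X nb d : @neighbours X nb d -> connected_structure X ->
  exists u : seq nat -> X, set_surj setT setT u.
Proof.
move=> nbP [C0 [[x0 _ C0E] comp1]].
(* A position beyond the end of the list leaves the walk where it is. *)
pose u l : X := foldl (fun x : {classic X} => nth x (nb x)) x0 l.
exists u => y _.
have x0y : component x0 y.
  have := comp1 (component y) (ex_intro2 _ _ y Logic.I erefl).
  rewrite (comp1 (component x0) (ex_intro2 _ _ x0 Logic.I erefl)) => ->.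
  exact: rt_refl.
have [l _ <-] : exists2 l, True & u l = y; last by exists l.
have : exists2 l, True & u l = x0 by exists [::].
elim: x0y => {y} [x y|//|x y z _ IH1 _ IH2 /IH1/IH2//].
move=> /(proj2 (nbP x) y) xy [l _ ul].
exists (rcons l (index (y : {classic X}) (nb x))) => //.
by rewrite /u foldl_rcons -/(u l) ul nth_index.
Qed.

(* [box (hood nb w)] consists of the substructures in which the range of [w] is
   retained and closed. *)
Definition hood X (nb : X -> seq {classic X}) (w : seq {classic X}) :=
  (undup w, [seq y <- undup (flatten (map nb w)) | y \notin w]).

Lemma hood_uniq X nb w : uniq ((@hood X nb w).1 ++ (hood nb w).2).
Proof.
rewrite cat_uniq undup_uniq filter_uniq ?undup_uniq// andbT; apply/hasPn => x.
by rewrite mem_filter => /andP[xw _]; rewrite /= mem_undup.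
Qed.

Lemma size_hood2 X nb d (w : seq {classic X}) : neighbours nb d ->
  size (hood nb w).2 <= size w * d.
Proof.
move=> nbP; rewrite /= size_filter; apply: leq_trans (count_size _ _) _.
apply: leq_trans (size_undup _) _; rewrite size_flatten.
elim: w => //= x w IH; rewrite mulSn leq_add//.
by have [] := nbP x.
Qed.

(** Duplicate the range of [z] together with [K] and its neighbours, and follow [z] along the
    isomorphism. The image misses [K] and the neighbours of [K], so its own neighbours miss [K]. *)
Lemma fresh_copy X nb d k (z : k.-tuple X) (K : seq {classic X}) :
  neighbours nb d -> duplicate_substructure_property X ->
  exists2 w : k.-tuple X, same_type z w &
    ~~ has (mem K) ((hood nb w).1 ++ (hood nb w).2).
Proof.
move=> nbP dupX; pose A := range (tnth z) `|` [set` K ++ flatten (map nb K)].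
have fA : finite_set A.
  rewrite finite_setU; split; first exact: finite_image.
  exact: (@finite_seq {classic X}).
have [B [AB _] [f bf fh]] := dupX A fA.
have [za zaE] : exists za : k.-tuple (induced A),
    map_tuple (inclusion A) za = z.
  by apply: lift_tuple => i; left; exists i.
pose wb := map_tuple f za.
exists (map_tuple (inclusion B) wb).
  apply: same_type_trans (same_type_val wb).
  apply: same_type_trans (same_type_map za (bij_inj bf) fh).
  apply: same_type_sym; rewrite -[X in same_type _ X]zaE.
  exact: same_type_val.
set w := map_tuple _ wb.
have wA x : x \in (w : seq {classic X}) -> ~ A x.
  move=> /(@tnthP _ {classic X})[i ->] Ai; rewrite tnth_map in Ai.
  have : (A `&` B) (val (tnth wb i : set_type B)).
    by split=> //; exact/set_mem/valP.
  by rewrite AB.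
apply/hasPn => x; rewrite mem_cat /= mem_filter !mem_undup => xw.
apply/negP => xK; case/orP: xw => [/wA|/andP[_ /flattenP[s sw xs]]].
  by apply; right; rewrite /= mem_cat xK.
have /(@mapP {classic X})[y yw sy] := sw.
move: xs; rewrite sy => xy; apply: (wA y yw); right.
rewrite /= mem_cat; apply/orP; right.
apply/flattenP; exists (nb x); first exact: (@map_f {classic X}).
by apply/(proj2 (nbP x)); apply: gaifman_sym; apply/(proj2 (nbP y)).
Qed.

(** The richness condition for one tuple [z] and one forbidden list [v], phrased through boxes of
    [X] so that its probability can be estimated. *)
Definition has_isolated_copy X (nb : X -> seq {classic X}) k (z : k.-tuple X)
    (v : seq {classic X}) (S : set X) : Prop :=
  exists w : k.-tuple X, [/\ same_type z w,
    forall i, (tnth w i : {classic X}) \notin v & box (hood nb w) S].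

Lemma isolated_copies_rich X nb d (S : set X) : neighbours nb d ->
  (forall k (z : k.-tuple X) v, has_isolated_copy nb z v S) ->
  rich X (induced S).
Proof.
move=> nbP HS k z V /finite_set_tuple[m [zv ->]].
have [w [zw wv /boxP[wS wnS]]] := HS k z (map (inclusion S) zv).
have [w' w'E] : exists w' : k.-tuple (induced S),
    map_tuple (inclusion S) w' = w.
  apply: lift_tuple => i; apply: wS; rewrite mem_undup.
  exact: (@mem_tnth _ {classic X}).
exists w'; split.
- apply: same_type_trans zw _; apply: same_type_sym; rewrite -w'E.
  exact: same_type_val.
- move=> i [j _ ji]; have /negP := wv i; apply.
  rewrite -w'E tnth_map -ji; apply: (@map_f {classic (set_type S)} {classic X}).
  exact: (@mem_tnth _ {classic (set_type S)}).
- move=> i y /gaifman_val iy.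
  have {}iy : gaifman (tnth w i) (val (y : set_type S)).
    by rewrite -w'E tnth_map.
  have [yw|yw] := boolP
    ((val (y : set_type S) : {classic X}) \in (w : seq {classic X})).
    have /(@tnthP _ {classic X})[j yj] := yw; exists j; apply: val_inj.
    by rewrite yj -w'E tnth_map.
  (* A neighbour outside [w] is among the deleted points of the box, yet [y] lies in [S]. *)
  exfalso; apply: (wnS (val (y : set_type S))); last exact/set_mem/valP.
  rewrite mem_filter yw mem_undup; apply/flattenP; exists (nb (tnth w i)).
    by apply: (@map_f {classic X}); exact: (@mem_tnth _ {classic X}).
  exact/(proj2 (nbP _)).
Qed.

Lemma measurable_isolated_copy (I : countType) X nb (u : I -> X) k
    (z : k.-tuple X) v : set_surj setT setT u ->
  measurable [set S : subset_space X | has_isolated_copy nb z v S].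
Proof.
move=> us; rewrite (_ : mkset _ = [set S : subset_space X |
    exists c : k.-tuple I, [/\ same_type z (map_tuple u c),
    forall i, (tnth (map_tuple u c) i : {classic X}) \notin v &
    box (hood nb (map_tuple u c)) S]]).
  apply: measurable_exists => c; have [zc|nzc] := pselect (
      same_type z (map_tuple u c) /\ forall i, (tnth (map_tuple u c) i : {classic X}) \notin v).
    rewrite (_ : mkset _ = box (hood nb (map_tuple u c))).
      by apply: box_measurable; exact: hood_uniq.
    by apply/seteqP; split=> S; [case|case: zc].
  rewrite (_ : mkset _ = set0) //.
  by apply/seteqP; split=> S // -[? ? _]; apply: nzc.
apply/seteqP; split=> S [] => [w ww|c cc]; last by exists (map_tuple u c).
have [c cw] : exists c : k.-tuple I, forall i, u (tnth c i) = tnth w i.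
  apply: (tuple_choice (P := fun i y => u y = tnth w i)) => i.
  by have [y _ yi] := us (tnth w i) Logic.I; exists y.
exists c; rewrite (_ : map_tuple u c = w) //.
by apply: eq_from_tnth => i; rewrite tnth_map.
Qed.

Local Open Scope ring_scope.

Lemma almost_surely_isolated_copy (R : realType) X (p : R)
    (mu : probability (subset_space X) R) nb d k (z : k.-tuple X) v :
  retention_measure p mu -> 0 < p -> p < 1 ->
  neighbours nb d -> duplicate_substructure_property X ->
  mu.-negligible [set S : subset_space X | ~ has_isolated_copy nb z v S].
Proof.
move=> mu_p p_gt0 p_lt1 nbP dupX.
have p0 := ltW p_gt0; have p1 := ltW p_lt1.
have q0 : 0 <= 1 - p by rewrite subr_ge0.
have q1 : 1 - p <= 1 by rewrite gerBl.
pose W := [set st | exists w : k.-tuple X, [/\ same_type z w,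
  forall i, (tnth w i : {classic X}) \notin v & st = hood nb w]].
apply: (negligibleS (A := ~` \bigcup_(st in W) box st)).
  move=> S nS [_ [w [zw wv ->]] bS]; apply: nS.
  by exists w.
(* A copy has at most [k] points to retain and at most [k * d] neighbours to delete. *)
apply: (mu_avoid_boxes mu_p p_gt0 p_lt1 (c := p ^+ k * (1 - p) ^+ (k * d)%N)).
- by rewrite mulr_gt0 ?exprn_gt0// subr_gt0.
- by rewrite mulr_ile1 ?exprn_ge0 ?exprn_ile1.
- by move=> _ [w [_ _ ->]]; exact: hood_uniq.
- move=> _ [w [_ _ ->]]; rewrite ler_pM ?exprn_ge0//.
    apply: ler_wiXn2l => //; rewrite -[X in (_ <= X)%N](size_tuple w).
    exact: size_undup.
  apply: ler_wiXn2l => //; apply: leq_trans (size_hood2 _ nbP) _.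
  by rewrite size_tuple.
(* Freshness for [v ++ K] gives both membership in [W] and a support disjoint from [K]. *)
- move=> K; have [w zw /hasPn wK] := fresh_copy z (v ++ K) nbP dupX.
  exists (hood nb w).
    exists w; split=> // i.
    have iw : (tnth w i : {classic X}) \in (hood nb w).1.
      by rewrite mem_undup (@mem_tnth _ {classic X}).
    have := wK (tnth w i).
    by rewrite mem_cat iw /= mem_cat negb_or => /(_ isT)/andP[].
  by apply/hasPn => x /wK; rewrite /= mem_cat negb_or => /andP[].
Qed.

End Copies.

(** * Conclusion for almost all substructures *)

Local Open Scope ring_scope.

Theorem theorem19 (R : realType) (Y : vocabulary) (X : structure Y)
    (p : R) (mu : probability (subset_space X) R)
    (A : set (fin_structure Y))
    (infX : infinite_set [set: X])
    (connX : connected_structure X)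
    (degX : bounded_degree X)
    (dupX : duplicate_substructure_property X)
    (repA : representatives A)
    (p_gt0 : 0 < p) (p_lt1 : p < 1)
    (mu_p : retention_measure p mu) :
  (let E := [set S : subset_space X |
               models (induced (S : set X)) (almost_sure_theory X A)] in
   measurable E /\ mu E = 1%E) /\
  (exists E : set (subset_space X),
     [/\ measurable E, mu E = 1%E &
         forall S S' : set X, E S -> E S' ->
           elementarily_equivalent (induced S) (induced S')]).
Proof.
have [d [nb nbP]] := bounded_degree_neighbours degX.
have [u us] := connected_countable nbP connX.
have fX : locally_finite X.
  by move=> x; have [n nX] := degX; apply/finite_set_leP; exists n.
(* Tuples and forbidden lists are named by walk codes, so that [E] is a countable intersection of
   almost sure events. *)
pose code := {k : nat & (k.-tuple (seq nat) * seq (seq nat))%type}.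
pose P (c : code) (S : subset_space X) :=
  has_isolated_copy nb (map_tuple u (tagged c).1) (map u (tagged c).2) S.
pose E := [set S | forall c, P c S].
have mP c : measurable [set S | P c S] by exact: measurable_isolated_copy us.
have mE : measurable E by exact: measurable_forall.
have muE : mu E = 1%E.
  apply: almost_surely_forall => // c.
  exact: almost_surely_isolated_copy mu_p p_gt0 p_lt1 nbP dupX.
have ER S : E S -> rich X (induced (S : set X)).
  move=> ES; apply: (isolated_copies_rich nbP) => k z v.
  have uP x : exists y, u y = x by have [y _ <-] := us x Logic.I; exists y.
  (* A right inverse of [u] chooses a code for every element, so [E] covers all [z] and [v]. *)
  have [h hK] : exists h, cancel h u.
    by exists (fun x => sval (cid (uP x))) => x; exact: (svalP (cid (uP x))).
  have := ES (existT _ k (map_tuple h z, map h v)); rewrite /P /=.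
  rewrite (_ : map_tuple u _ = z); first by rewrite mapK.
  by apply: eq_from_tnth => i; rewrite !tnth_map hK.
split.
  have mM := measurable_models A us; split=> //.
  (* Every member of [E] is a model, so the event of being a model has measure at least that of
     [E]. *)
  apply/eqP; rewrite eq_le probability_le1//= -muE le_measure ?inE//.
  by move=> S /ER /rich_models; apply.
exists E; split=> // S S' ES ES'; apply: rich_elementarily_equivalent.
- exact: locally_finite_induced.
- exact: locally_finite_induced.
- exact/rich_induced/ER.
- exact/rich_induced/ER.
Qed.
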